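(* Let $P$ be a poset with least element $0$ and with $Z(P)^\times\neq\emptyset$. Identify each annihilator ideal $\mathrm{ann}(x)$, $x\in Z(P)^\times$, with the vertex $[x]$ of $\Gamma_E(P)$, so that $\mathrm{Ann}(P)$ is regarded as a set of vertices of $\Gamma_E(P)$. Then the following assertions hold: (a) $\mathrm{Ann}(P)$ is a clique of $\Gamma_E(P)$. (b) Given a vertex $[z]$ of $\Gamma_E(P)$, one has $[z]\in \mathrm{Ann}(P)$ (that is, $\mathrm{ann}(z)$ is a prime ideal of $P$) if and only if no two vertices in the set $V(\Gamma_E(P))\setminus \mathrm{nbd}([z])$ are adjacent in $\Gamma_E(P)$. (c) If $P$ is a poset with ACC for annihilators, then every vertex in $\Gamma_E(P)$ is adjacent to an annihilator prime ideal; consequently, $|\mathrm{Ann}(P)|\geq 2$.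
   Context: For a poset $P$ with least element $0$ and $x,y\in P$: $L(x,y)=\{z\in P\mid z\le x,\ z\le y\}$, $\mathrm{ann}(x)=\{y\in P\mid L(x,y)=\{0\}\}$, $P^\times=P\setminus\{0\}$. An element $x\in P$ is a zero-divisor if $L(x,y)=\{0\}$ for some $y\in P^\times$; $Z(P)$ is the set of zero-divisors and $Z(P)^\times=Z(P)\setminus\{0\}$. An ideal of $P$ is a non-empty down-closed subset $I\subseteq P$ (no directedness is required). A prime ideal is an ideal $\mathfrak p\neq P$ such that for all $x,y\in P$, $L(x,y)\subseteq\mathfrak p$ implies $x\in\mathfrak p$ or $y\in\mathfrak p$. An annihilator prime ideal is a prime ideal of the form $\mathrm{ann}(x)$ with $x\in P$; $\mathrm{Ann}(P)$ is the set of all annihilator prime ideals. (Under the assumption $Z(P)^\times\ne\emptyset$, every annihilator prime ideal is $\mathrm{ann}(x)$ for some $x\in Z(P)^\times$.) Write $x\sim y$ if $\mathrm{ann}(x)=\mathrm{ann}(y)$, and $[x]$ for the class of $x$. $\Gamma_E(P)$ is the simple graph whose vertices are the classes $[x]$, $x\in Z(P)^\times$, with $[x]$ and $[y]$ adjacent iff $L(x,y)=\{0\}$ (this is well defined). The map $\mathrm{ann}(x)\mapsto[x]$ is a bijection from $\{\mathrm{ann}(x)\mid x\in Z(P)^\times\}$ onto $V(\Gamma_E(P))$; a vertex $[x]$ is called an annihilator prime ideal if $\mathrm{ann}(x)\in\mathrm{Ann}(P)$. $\mathrm{nbd}(v)$ denotes the set of vertices adjacent to the vertex $v$. A clique is a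 set of pairwise adjacent vertices. $P$ is a poset with ACC for annihilators if there is no infinite strictly ascending chain, under inclusion, in the set $\{\mathrm{ann}(x)\mid x\in P^\times\}$. *)

(* Defs.v *)
From mathcomp Require Import all_boot all_order.
From mathcomp Require Import boolp classical_sets functions cardinality.

Set Implicit Arguments.
Unset Strict Implicit.
Unset Printing Implicit Defensive.

Import Order.TTheory.

Local Open Scope classical_set_scope.
Local Open Scope order_scope.

Section PosetZeroDivisors.
Context {d : Order.disp_t} {P : bPOrderType d}.
Implicit Types (x y z : P) (I p : set P) (u v : set P).

Definition lower x y : set P := [set z | z <= x /\ z <= y].

Definition ann x : set P := [set y | lower x y = [set \bot]].

Definition nonzero : set P := [set x | x <> \bot].

Definition zero_divisor : set P :=
  [set x | exists2 y, nonzero y & lower x y = [set \bot]].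

Definition zero_divisorX : set P := zero_divisor `\ \bot.

Definition ideal I : Prop :=
  I !=set0 /\ forall x y, y <= x -> I x -> I y.

Definition prime_ideal p : Prop :=
  [/\ ideal p, p <> setT &
      forall x y, lower x y `<=` p -> p x \/ p y].

Definition Ann : set (set P) :=
  [set p | prime_ideal p /\ exists x, p = ann x].

Definition cls x : set P := [set y | ann y = ann x].

(* The vertices of Gamma_E(P) are the classes themselves, seen as subsets of P;
   a class taken in all of P is contained in [zero_divisorX] as soon as it
   meets it (see [cls_sub]). *)
Definition GammaE_vertex : set (set P) := cls @` zero_divisorX.

Definition GammaE_adj u v : Prop :=
  exists x y, [/\ zero_divisorX x, zero_divisorX y, u = cls x, v = cls y &
                  lower x y = [set \bot]].

Definition nbd v : set (set P) := [set u | GammaE_adj v u].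

Definition GammaE_clique (C : set (set P)) : Prop :=
  C `<=` GammaE_vertex /\
  forall u v, C u -> C v -> u <> v -> GammaE_adj u v.

(* [Ann] transported along the bijection ann(x) |-> [x]. *)
Definition Ann_vertex : set (set P) :=
  cls @` [set x | zero_divisorX x /\ Ann (ann x)].

Definition ACC_ann : Prop :=
  ~ exists f : nat -> set P,
      (forall n, (ann @` nonzero) (f n)) /\ (forall n, f n `<` f n.+1).

Lemma lowerC x y : lower x y = lower y x.
Proof. by apply/seteqP; split=> z /= []. Qed.

Lemma cls_inj x y : cls x = cls y <-> ann x = ann y.
Proof.
split=> [e|e]; last by rewrite /cls e.
by have : cls x x by []; rewrite e.
Qed.

Lemma ann_bot : ann (\bot : P) = setT.
Proof.
apply/seteqP; split=> // y _; apply/seteqP; split=> z /=.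
  by case; rewrite lex0 => /eqP.
by move=> ->; split; rewrite le0x.
Qed.

Lemma ann_self x : ann x x -> x = \bot.
Proof. by move=> h; have : lower x x x by []; rewrite h. Qed.

Lemma cls_sub x : zero_divisorX x -> cls x `<=` zero_divisorX.
Proof.
case=> -[w w0 hw] /= x0 y /= e; split.
  by exists w => //; have : ann x w by []; rewrite -e.
by move=> y0; apply: x0; apply: ann_self; rewrite -e y0 ann_bot.
Qed.

(* Adjacency does not depend on the chosen representatives. *)
Lemma GammaE_adjE x y : zero_divisorX x -> zero_divisorX y ->
  GammaE_adj (cls x) (cls y) <-> lower x y = [set \bot].
Proof.
move=> hx hy; split=> [[x' [y' [_ _ /cls_inj ex /cls_inj ey h]]]|h].
  have : ann x' y' by [].
  rewrite -ex /ann /= lowerC => h'.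
  by have : ann y' x by []; rewrite -ey /ann /= lowerC.
by exists x, y.
Qed.

Lemma GammaE_adj_sym u v : GammaE_adj u v -> GammaE_adj v u.
Proof. by move=> [x [y [? ? ? ? h]]]; exists y, x; split=> //; rewrite lowerC. Qed.

Lemma GammaE_adj_irr v : ~ GammaE_adj v v.
Proof.
move=> [x [y [hx hy e e' h]]]; case: hx => _ /= x0; apply: x0.
apply: ann_self; have /cls_inj -> : cls x = cls y by rewrite -e.
by rewrite /ann /= lowerC.
Qed.

Lemma Ann_vertexE z : zero_divisorX z ->
  Ann_vertex (cls z) <-> prime_ideal (ann z).
Proof.
move=> hz; split=> [[x [_ [h _]] /cls_inj <-] //|h].
by exists z => //; split=> //; split=> //; exists z.
Qed.

Lemma Ann_ann : zero_divisorX !=set0 ->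
  Ann = ann @` [set x | zero_divisorX x /\ Ann (ann x)].
Proof.
move=> [a [[b b0 hab] /= a0]]; apply/seteqP; split=> [p [hp [x e]]|p [x [_ h] <-] //].
have x0 : x <> \bot by move=> x0; case: hp => _; rewrite e x0 ann_bot.
exists x => //; split; last by split; [rewrite -e | exists x].
split=> //; case: hp => _ _ /(_ a b); case.
- by rewrite hab e => z ->; rewrite /ann /= lowerC; have : ann \bot x by rewrite ann_bot.
- by rewrite e => h; exists a.
- by rewrite e => h; exists b.
Qed.

(* Counting annihilator prime ideals as ideals or as vertices is the same. *)
Lemma Ann_card : zero_divisorX !=set0 -> (Ann #= Ann_vertex)%card.
Proof.
move=> /Ann_ann e; rewrite e /Ann_vertex.
set S := [set x | _].
have -> : cls @` S = (fun p => [set y | ann y = p]) @` (ann @` S).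
  by rewrite image_comp.
rewrite card_eq_sym; apply: inj_card_eq => //.
move=> p q /set_mem [x _ <-] /set_mem [y _ <-] /= h.
by apply/cls_inj.
Qed.

End PosetZeroDivisors.

Arguments zero_divisor {d} P.
Arguments zero_divisorX {d} P.
Arguments nonzero {d} P.
Arguments Ann {d} P.
Arguments GammaE_vertex {d} P.
Arguments Ann_vertex {d} P.
Arguments ACC_ann {d} P.

(* Main.v *)
(** Primality of [ann z] can be tested below [z]: if [a] and [b] lie outside
    [ann z], they have nonzero lower bounds [a'], [b'] in common with [z], and
    [L(a, b)] contained in [ann z] forces [L(a', b') = {0}]. This gives (b), and
    it shows that a maximal element among the [ann y] with [y] nonzero in
    [ann x] is prime, since [ann y] is contained in [ann a'] and [ann b']. *)
Require Import Defs.
From mathcomp Require Import all_boot all_order.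
From mathcomp Require Import boolp classical_sets functions cardinality.

Import Order.TTheory.

Local Open Scope classical_set_scope.

Lemma card_ge2 (T : Type) (A : set T) (p q : T) :
  A p -> A q -> p <> q -> (`I_2 #<= A)%card.
Proof.
move=> Ap Aq pq; pose f n := if n == 0 then p else q.
apply/card_subP; exists (f @` `I_2).
  rewrite inj_card_eq// => m n /set_mem /= m2 /set_mem /= n2.
  by case: m n m2 n2 => [|[|m]] [|[|n]] //= _ _ e; case: pq.
by move=> _ [n _ <-]; rewrite /f; case: ifP.
Qed.

Section Annihilators.
Set Implicit Arguments.
Unset Strict Implicit.
Context {d : Order.disp_t} {P : bPOrderType d}.
Implicit Types x y z a b t : P.
Local Open Scope order_scope.

(** Only one inclusion of [lower x y = [set \bot]] carries information, since [\bot] lies below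
    everything. *)
Lemma annP x y : ann x y <-> forall t, t <= x -> t <= y -> t = \bot.
Proof.
split=> [h t tx ty|h]; first by have : lower x y t by []; rewrite h.
apply/seteqP; split=> t /= => [[]|->]; first exact: h.
by split; exact: le0x.
Qed.

Lemma ann_sym x y : ann x y -> ann y x.
Proof. by rewrite /ann /= lowerC. Qed.

Lemma ann_le x y z : y <= x -> ann z x -> ann z y.
Proof. by move=> yx /annP h; apply/annP => t tz ty; apply: h => //; exact: le_trans yx. Qed.

Lemma subset_ann x y : y <= x -> ann x `<=` ann y.
Proof. by move=> yx t /ann_sym h; apply: ann_sym; exact: ann_le h. Qed.

(** When [y <= x], the element [y] is itself a common lower bound of [x] and [y]. *)
Lemma ann_below x y : ann x y -> y <= x -> y = \bot.
Proof. by move=> /annP h yx; apply: h. Qed.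

Lemma notin_ann x y : ~ ann x y -> exists2 t, t <> \bot & t <= x /\ t <= y.
Proof.
move=> nh; apply: contrapT => h; apply: nh; apply/annP => t tx ty.
by apply: contrapT => t0; apply: h; exists t.
Qed.

Lemma zero_divisorX_ann x y : x <> \bot -> y <> \bot -> ann x y ->
  zero_divisorX P x.
Proof. by move=> x0 y0 xy; split=> //; exists y. Qed.

Lemma prime_ann z : z <> \bot ->
  (forall a b, a <> \bot -> b <> \bot -> a <= z -> b <= z -> ~ ann a b) ->
  prime_ideal (ann z).
Proof.
move=> z0 h; split.
- split; first by exists \bot; apply: ann_sym; rewrite ann_bot.
  by move=> x y yx; exact: ann_le.
- by move=> e; apply: z0; apply: ann_self; rewrite e.
- move=> a b ab; apply: contrapT => /not_orP[].
  move=> /notin_ann[a' a0 [a'z a'a]] /notin_ann[b' b0 [b'z b'b]].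
  (* A common lower bound [t] of [a'] and [b'] lies in [lower a b], hence in [ann z], and also below
     [z] through [a']; so it is [\bot]. *)
  apply: (h a' b') => //; apply/annP => t ta tb.
  apply: (@ann_below z); last exact: le_trans a'z.
  by apply: ab; split; [exact: le_trans a'a | exact: le_trans b'b].
Qed.

Lemma prime_ann_mem z a b : prime_ideal (ann z) -> ann a b -> ann z a \/ ann z b.
Proof.
move=> [_ _ pr] ab; apply: pr; rewrite ab => _ ->.
by apply: ann_sym; rewrite ann_bot.
Qed.

Lemma prime_ann_subset x y : prime_ideal (ann x) -> ~ ann x y -> ann y `<=` ann x.
Proof. by move=> px nxy t /(prime_ann_mem px)[]. Qed.

(** If [x] and [y] did not annihilate each other, each prime annihilator would contain the other:
    from [ann y t], primality of [ann x] yields [ann x t], and symmetrically. *)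
Lemma prime_ann_adj x y : prime_ideal (ann x) -> prime_ideal (ann y) ->
  ann x <> ann y -> ann x y.
Proof.
move=> px py; apply: contra_notP => nxy; apply/seteqP; split.
  by apply: prime_ann_subset => // /ann_sym.
exact: prime_ann_subset.
Qed.

Lemma ACC_ann_max (S : set P) : ACC_ann P -> S !=set0 -> S `<=` nonzero P ->
  exists2 y, S y & forall t, S t -> ann y `<=` ann t -> ann t = ann y.
Proof.
move=> acc [y0 Sy0] S0; apply: contrapT => nomax; apply: acc.
(* Without a maximal annihilator, every [y] in [S] has a strictly larger successor. Placing [S y]
   inside the existential makes the relation total on [P], so choice gives a map [g] whose iterates
   from [y0] form a forbidden chain. *)
have /choice[g gP] (y : P) : exists t, S y -> S t /\ ann y `<` ann t.
  apply: contrapT => /forallNP h; apply: nomax; exists y.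
    by apply: contrapT => nSy; apply: (h y) => /nSy.
  move=> t St yt; apply: contrapT => ne; apply: (h t) => _; split=> //.
  by split=> // ty; apply: ne; apply/seteqP.
have Sg n : S (iter n g y0) by elim: n => //= n /gP[].
exists (fun n => ann (iter n g y0)); split=> n; last by have [] := gP _ (Sg n).
by exists (iter n g y0) => //; exact/S0/Sg.
Qed.

Lemma prime_ann_exists x : ACC_ann P -> zero_divisorX P x ->
  exists y, [/\ zero_divisorX P y, ann x y & prime_ideal (ann y)].
Proof.
move=> acc [[w w0 xw] /= x0].
have [||y [xy y0] ymax] := @ACC_ann_max (ann x `&` nonzero P) acc.
- by exists w.
- by move=> ? [].
exists y; split=> //; first exact/(@zero_divisorX_ann _ x)/ann_sym.
(* Since [a <= y], the element [a] also competes in [ann x], and maximality gives [ann a = ann y].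
   Then [b] lies both in [ann y] and below [y], so it vanishes. *)
apply: prime_ann => // a b a0 b0 ay b_y ab; apply: b0.
apply: (@ann_below y) => //; rewrite -(ymax a) //; last exact: subset_ann.
by split=> //; exact: ann_le xy.
Qed.

Lemma GammaE_clique_Ann : GammaE_clique (Ann_vertex P).
Proof.
split=> [_ [x [hx _] <-]|_ _ [x [hx [px _]] <-] [y [hy [py _]] <-] ne].
  by exists x.
by exists x, y; split=> //; apply: prime_ann_adj => // /cls_inj.
Qed.

Lemma Ann_vertex_nbdC z : zero_divisorX P z ->
  Ann_vertex P (cls z) <->
  forall u v : set P,
    (GammaE_vertex P `\` nbd (cls z)) u -> (GammaE_vertex P `\` nbd (cls z)) v ->
    ~ GammaE_adj u v.
Proof.
move=> hz; rewrite Ann_vertexE//; split.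
  move=> pz _ _ [[a ha <-] na] [[b hb <-] nb] /GammaE_adjE-/(_ ha hb).
  by move=> /(prime_ann_mem pz)[/(GammaE_adjE hz ha)|/(GammaE_adjE hz hb)].
move=> h; apply: prime_ann => [|a b a0 b0 az bz ab]; first by case: hz.
have ha : zero_divisorX P a by exact: zero_divisorX_ann ab.
have hb : zero_divisorX P b by exact/(@zero_divisorX_ann _ a)/ann_sym.
(* Nonzero elements below [z] cannot annihilate [z], so both classes lie outside [nbd (cls z)], yet
   [ann a b] makes them adjacent. *)
apply: (h (cls a) (cls b)); last exact/GammaE_adjE.
- split; first by exists a.
  by move=> /(GammaE_adjE hz ha) /ann_below /(_ az).
- split; first by exists b.
  by move=> /(GammaE_adjE hz hb) /ann_below /(_ bz).
Qed.

Lemma GammaE_adj_Ann_exists v : ACC_ann P -> GammaE_vertex P v ->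
  exists2 u, Ann_vertex P u & GammaE_adj v u.
Proof.
move=> acc [x hx <-]; have [y [hy xy py]] := prime_ann_exists acc hx.
by exists (cls y); [exact/Ann_vertexE | exact/GammaE_adjE].
Qed.

(** The existence result is used twice: a prime [ann y] adjacent to [x], then a prime [ann z]
    adjacent to [y]. Equality of the two would make [z] annihilate itself. *)
Lemma Ann_ge2 : zero_divisorX P !=set0 -> ACC_ann P -> (`I_2 #<= Ann P)%card.
Proof.
move=> [x hx] acc.
have [y [hy _ py]] := prime_ann_exists acc hx.
have [z [hz yz pz]] := prime_ann_exists acc hy.
apply: (@card_ge2 _ _ (ann y) (ann z)).
- by split=> //; exists y.
- by split=> //; exists z.
- by move=> e; case: hz => _; apply; apply: ann_self; rewrite -e.
Qed.

End Annihilators.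

Theorem proposition4p4 (d : Order.disp_t) (P : bPOrderType d)
    (hZ : zero_divisorX P !=set0) :
  [/\ (* (a) *)
      GammaE_clique (Ann_vertex P),
      (* (b) *)
      forall z : P, zero_divisorX P z ->
        (Ann_vertex P (cls z) <->
         forall u v : set P,
           (GammaE_vertex P `\` nbd (cls z)) u ->
           (GammaE_vertex P `\` nbd (cls z)) v ->
           ~ GammaE_adj u v)
    & (* (c) *)
      ACC_ann P ->
        (forall v : set P, GammaE_vertex P v ->
           exists2 u : set P, Ann_vertex P u & GammaE_adj v u) /\
        (`I_2 #<= Ann P)%card].
Proof.
split; [exact: GammaE_clique_Ann | exact: Ann_vertex_nbdC |].
by move=> acc; split=> [v|]; [exact: GammaE_adj_Ann_exists | exact: Ann_ge2].
Qed.
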